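(* Let $\Bbbk$ be a field of characteristic zero, $\mathfrak g_\circ=\bigoplus_{j=1}^6L_j$ the $14$-dimensional graded Lie algebra and $P\subset H^2_0(\mathfrak g_\circ;\mathfrak g_\circ)$ the pencil-motion subspace defined in the context, and $$E_{\mathrm{top}}=\operatorname{Hom}(L_2\otimes L_4,L_6)\oplus\operatorname{Hom}(\Lambda^2L_3,L_6).$$ Relative to the fixed grading, terminal restriction $[\phi]\mapsto(\phi|_{L_2\otimes L_4},\phi|_{\Lambda^2L_3})$ induces a canonical isomorphism $$H^2_0(\mathfrak g_\circ;\mathfrak g_\circ)/P\xrightarrow{\ \sim\ }E_{\mathrm{top}}.$$ Thus the eight transverse components are exactly the possible terminal internal–internal brackets $L_2\otimes L_4\to L_6$ and $\Lambda^2L_3\to L_6$; the cocycle equation then determines their lower-layer metabelian defects up to gauge (coboundaries) and pencil motion $P$.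
   Context: $\mathfrak g_\circ$ has homogeneous basis $X,Y\in L_1$; $Z_0\in L_2$; $Z_x,Z_y\in L_3$; $Z_{x^2},Z_{xy},Z_{y^2}\in L_4$; $Z_{x^3},Z_{x^2y},Z_{xy^2},Z_{y^3}\in L_5$; $T_0,T_1\in L_6$. The bracket is $[X,Y]=Z_0$, $[X,Z_p]=Z_{xp}$, $[Y,Z_p]=Z_{yp}$ for monomials $p$ in $x,y$ of degree $\le3$ (with $Z_1=Z_0$), where $Z_{x^4}=Z_{y^4}=T_0$, $Z_{x^3y}=Z_{xy^3}=T_1$, $Z_{x^2y^2}=0$; $L_6$ is central and the derived algebra $\mathfrak d=\bigoplus_{j\ge2}L_j$ is abelian. $H^2_0$ is the degree-zero part of adjoint Chevalley–Eilenberg cohomology (cochains with $f(L_i,L_j)\subseteq L_{i+j}$). The metabelian defect of a class $[\phi]\in H^2_0$ is $\phi|_{\Lambda^2\mathfrak d}$ (well defined, as degree-zero coboundaries vanish on $\Lambda^2\mathfrak d$); terminal restriction keeps only its two components with values in $L_6$, and $\dim E_{\mathrm{top}}=6+2=8$. $P=\operatorname{span}\{[\psi_0],[\psi_1],[\psi_2]\}$, where the 2-cocycles $\psi_i$ have only the nonzero values (up to antisymmetry) $\psi_0(X,Z_{x^3})=T_0$; $\psi_1(X,Z_{x^2y})=\psi_1(Y,Z_{x^3})=T_0$; $\psi_2(X,Z_{xy^2})=\psi_2(Y,Z_{x^2y})=T_0$. *)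

(* Defs.v *)
(* The classical axioms of boolp are used only for [vspace_of]. *)
From HB Require Import structures.
From mathcomp Require Import all_boot all_order all_algebra.
From mathcomp Require Import generic_quotient ring_quotient.
From mathcomp Require Import boolp.
From mathcomp Require Import ring.

Set Implicit Arguments.
Unset Strict Implicit.
Unset Printing Implicit Defensive.

Import GRing.Theory.
Local Open Scope ring_scope.

Section Submodule.
Variables (F : fieldType) (V : vectType F).

Definition submodule (P : V -> Prop) :=
  P 0 /\ forall a u v, P u -> P v -> P (a *: u + v).

Lemma vspace_of_subproof (P : V -> Prop) : submodule P ->
  exists U : {vspace V}, forall v, v \in U <-> P v.
Proof.
move=> [P0 PD].
pose D n := `[< exists U : {vspace V}, \dim U = n /\ forall v, v \in U -> P v >].
have exD : exists n, D n.
  exists 0%N; apply/asboolP; exists 0%VS; split; first exact: dimv0.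
  by move=> v; rewrite memv0 => /eqP ->.
have leD n : D n -> (n <= \dim {:V})%N.
  by move=> /asboolP[U [<- _]]; apply: dimvS; apply: subvf.
case: (ex_maxnP exD leD) => n /asboolP[U [dU UP]] maxn_.
exists U => v; split=> [/UP //|Pv].
case: (boolP (v \in U)) => // vU.
suff /maxn_ : D (\dim (U + <[v]>)%VS).
  rewrite -dU => le_dim.
  have := eqEdim U (U + <[v]>)%VS; rewrite addvSl le_dim /= => /eqP eqU.
  by case/negP: vU; rewrite eqU memvE addvSr.
apply/asboolP; exists (U + <[v]>)%VS; split=> // w /memv_addP[u uU [w' /vlineP[k ->] ->]].
by rewrite addrC; apply: PD => //; apply: UP.
Qed.

Definition vspace_of (P : V -> Prop) (hP : submodule P) : {vspace V} :=
  sval (cid (vspace_of_subproof hP)).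

Lemma mem_vspace_of (P : V -> Prop) (hP : submodule P) v :
  v \in vspace_of hP <-> P v.
Proof. by rewrite /vspace_of; case: cid. Qed.

End Submodule.

Section QuotientSpace.
Variables (F : fieldType) (V : vectType F) (U : {vspace V}).
Local Open Scope quotient_scope.

Definition quotv := Quotient.quot (U : zmodClosed V).
HB.instance Definition _ := Choice.on quotv.
HB.instance Definition _ := EqQuotient.on quotv.
HB.instance Definition _ := GRing.Zmodule.on quotv.

Definition qproj (v : V) : quotv := \pi_quotv v.

Lemma qproj_eq u v : (qproj u == qproj v) = (u - v \in U).
Proof. by rewrite /qproj -(Quotient.idealrBE (U : zmodClosed V) u v). Qed.

Lemma qproj_surj q : exists v, q = qproj v.
Proof. by exists (repr q); rewrite /qproj reprK. Qed.

Lemma qprojD u v : qproj (u + v) = qproj u + qproj v.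
Proof. by rewrite /qproj !piE. Qed.

Definition qscale (a : F) (q : quotv) : quotv := qproj (a *: repr q).

Lemma qprojZ a v : qproj (a *: v) = qscale a (qproj v).
Proof.
apply/eqP; rewrite qproj_eq -scalerBr memvZ // -qproj_eq.
by rewrite /qproj reprK.
Qed.

Fact qscaleA a b q : qscale a (qscale b q) = qscale (a * b) q.
Proof. by have [v ->] := qproj_surj q; rewrite -!qprojZ scalerA. Qed.
Fact qscale1 : left_id 1 qscale.
Proof. by move=> q; have [v ->] := qproj_surj q; rewrite -qprojZ scale1r. Qed.
Fact qscaleDr : right_distributive qscale +%R.
Proof.
move=> a q r; have [u ->] := qproj_surj q; have [v ->] := qproj_surj r.
by rewrite -qprojD -!qprojZ -qprojD scalerDr.
Qed.
Fact qscaleDl q : {morph qscale^~ q : a b / a + b}.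
Proof.
by move=> a b; have [v ->] := qproj_surj q; rewrite -!qprojZ -qprojD scalerDl.
Qed.
HB.instance Definition _ :=
  GRing.Zmodule_isLmodule.Build F quotv qscaleA qscale1 qscaleDr qscaleDl.

Fact qproj_is_linear : linear qproj.
Proof. by move=> a u v; rewrite qprojD qprojZ. Qed.
HB.instance Definition _ :=
  GRing.isLinear.Build F V quotv *:%R qproj qproj_is_linear.

Definition qsection (q : quotv) : subvs_of U^C :=
  vsproj U^C (repr q - projv U (repr q)).

Fact qsectionE v : vsval (qsection (qproj v)) = v - projv U v.
Proof.
rewrite /qsection vsprojK ?memv_projC //.
set w := repr _; have wv : w - v \in U by rewrite -qproj_eq /qproj reprK.
by rewrite -(subrK v w) linearD /= (projv_id wv) opprD addrACA subrr add0r.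
Qed.

Import VectorInternalTheory.
Fact quotv_vector_axiom : Vector.axiom (dim (subvs_of U^C)) quotv.
Proof.
have sec_linear : linear qsection.
  move=> a q r; have [u ->] := qproj_surj q; have [v ->] := qproj_surj r.
  rewrite -linearP; apply: subvs_inj; rewrite [RHS]linearP !qsectionE linearP.
  by rewrite /= !qsectionE scalerBr opprD addrACA.
exists (v2r \o qsection) => [a q r|].
  by rewrite /comp sec_linear linearP.
apply: bij_comp; first by exists r2v; [exact: v2rK | exact: r2vK].
exists (fun w => qproj (vsval w)) => [q|w].
  have [v ->] := qproj_surj q; apply/eqP.
  by rewrite qsectionE qproj_eq addrAC subrr add0r memvN memv_proj.
apply: subvs_inj; rewrite qsectionE.
have UC : (U :&: U^C = 0)%VS by exact: capv_compl.
have := daddv_pi_add UC (w := vsval w); rewrite addv_complf memvf => /(_ isT).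
rewrite [daddv_pi U^C U _]daddv_pi_id ?subvsP 1?capvC // => e.
by rewrite -[X in X - _]e /projv addrAC subrr add0r.
Qed.
HB.instance Definition _ :=
  Lmodule_hasFinDim.Build F quotv quotv_vector_axiom.
End QuotientSpace.

Inductive gbasis :=
  | gX | gY | gZ0 | gZx | gZy | gZx2 | gZxy | gZy2
  | gZx3 | gZx2y | gZxy2 | gZy3 | gT0 | gT1.

Definition gbasis_enum :=
  [:: gX; gY; gZ0; gZx; gZy; gZx2; gZxy; gZy2; gZx3; gZx2y; gZxy2; gZy3;
      gT0; gT1].

Definition gbasis_code (b : gbasis) : nat :=
  match b with
  | gX => 0 | gY => 1 | gZ0 => 2 | gZx => 3 | gZy => 4 | gZx2 => 5
  | gZxy => 6 | gZy2 => 7 | gZx3 => 8 | gZx2y => 9 | gZxy2 => 10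
  | gZy3 => 11 | gT0 => 12 | gT1 => 13
  end.

Fact gbasis_codeK : cancel gbasis_code (nth gX gbasis_enum).
Proof. by case. Qed.
HB.instance Definition _ := Countable.copy gbasis (can_type gbasis_codeK).
Fact gbasis_enumP : Finite.axiom gbasis_enum. Proof. by case. Qed.
HB.instance Definition _ := isFinite.Build gbasis gbasis_enumP.

Definition gdeg (b : gbasis) : nat :=
  match b with
  | gX | gY => 1
  | gZ0 => 2
  | gZx | gZy => 3
  | gZx2 | gZxy | gZy2 => 4
  | gZx3 | gZx2y | gZxy2 | gZy3 => 5
  | gT0 | gT1 => 6
  end.

Definition gtable := gbasis -> gbasis -> option gbasis.

(* Each unordered pair with a nonzero bracket occurs in one order only; the
   opposite order is supplied by antisymmetry in [table_val]. The values in
   degree 6 come from Z_(x^4) = Z_(y^4) = T_0, Z_(x^3y) = Z_(xy^3) = T_1 and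
   Z_(x^2y^2) = 0. *)
Definition lie_table : gtable := fun u v =>
  match u, v with
  | gX, gY => Some gZ0
  | gX, gZ0 => Some gZx     | gY, gZ0 => Some gZy
  | gX, gZx => Some gZx2    | gY, gZx => Some gZxy
  | gX, gZy => Some gZxy    | gY, gZy => Some gZy2
  | gX, gZx2 => Some gZx3   | gY, gZx2 => Some gZx2y
  | gX, gZxy => Some gZx2y  | gY, gZxy => Some gZxy2
  | gX, gZy2 => Some gZxy2  | gY, gZy2 => Some gZy3
  | gX, gZx3 => Some gT0    | gY, gZx3 => Some gT1
  | gX, gZx2y => Some gT1   | gY, gZx2y => None
  | gX, gZxy2 => None       | gY, gZxy2 => Some gT1
  | gX, gZy3 => Some gT1    | gY, gZy3 => Some gT0
  | _, _ => None
  end.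

Definition psi_table (i : 'I_3) : gtable := fun u v =>
  match val i, u, v with
  | 0, gX, gZx3 => Some gT0
  | 1, gX, gZx2y => Some gT0
  | 1, gY, gZx3 => Some gT0
  | 2, gX, gZxy2 => Some gT0
  | 2, gY, gZx2y => Some gT0
  | _, _, _ => None
  end.

Definition gcirc (F : fieldType) : vectType F := {ffun gbasis -> F^o}.
Definition cochain2 (F : fieldType) : vectType F :=
  'Hom(gcirc F, 'Hom(gcirc F, gcirc F)).

Section LieAlgebra.
Variable F : fieldType.
Local Notation g := (gcirc F).

Definition gbas (b : gbasis) : g := [ffun c => (c == b)%:R].

Definition gbaso (o : option gbasis) : g := oapp gbas 0 o.

Definition table_val (t : gtable) u v : g := gbaso (t u v) - gbaso (t v u).

Definition table_map (t : gtable) (x y : g) : g :=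
  \sum_u \sum_v (x u * y v) *: table_val t u v.

Fact table_map_linear t x : linear (table_map t x).
Proof.
move=> a y z; rewrite /table_map scaler_sumr -big_split; apply: eq_bigr => u _.
rewrite scaler_sumr -big_split; apply: eq_bigr => v _ /=.
by rewrite scalerA -scalerDl !ffunE mulrDr mulrCA.
Qed.
HB.instance Definition _ t x :=
  GRing.isLinear.Build F g g *:%R (table_map t x) (table_map_linear t x).

Definition table_hom (t : gtable) (x : g) : 'Hom(g, g) := linfun (table_map t x).

Fact table_hom_linear t : linear (table_hom t).
Proof.
move=> a x y; apply/lfunP => z; rewrite add_lfunE scale_lfunE !lfunE /=.
rewrite /table_map scaler_sumr -big_split; apply: eq_bigr => u _.
rewrite scaler_sumr -big_split; apply: eq_bigr => v _ /=.
by rewrite scalerA -scalerDl !ffunE mulrDl mulrA.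
Qed.
HB.instance Definition _ t := GRing.isLinear.Build F g 'Hom(g, g) *:%R
  (table_hom t) (table_hom_linear t).

(* The alternating bilinear map e_u, e_v |-> e_(t u v) - e_(t v u). *)
Definition table_cochain (t : gtable) : cochain2 F := linfun (table_hom t).

Lemma table_cochainE t x y :
  table_cochain t x y = \sum_u \sum_v (x u * y v) *: table_val t u v.
Proof. by rewrite !lfunE. Qed.

Lemma table_cochain_bas t u v :
  table_cochain t (gbas u) (gbas v) = table_val t u v.
Proof.
rewrite table_cochainE (bigD1 u) //= (bigD1 v) //= !ffunE !eqxx mulr1 scale1r.
rewrite !big1 ?addr0 // => [u' nu|v' nv].
  by rewrite big1 // => v' _; rewrite !ffunE (negPf nu) mul0r scale0r.
by rewrite !ffunE (negPf nv) mulr0 scale0r.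
Qed.

Lemma table_valC t u v : table_val t u v = - table_val t v u.
Proof. by rewrite opprB. Qed.

Lemma table_cochainC t x y : table_cochain t x y = - table_cochain t y x.
Proof.
rewrite !table_cochainE -sumrN exchange_big; apply: eq_bigr => u _ /=.
rewrite -sumrN; apply: eq_bigr => v _.
by rewrite table_valC scalerN mulrC.
Qed.

Lemma table_cochainxx t x : table_cochain t x x = 0.
Proof.
rewrite table_cochainE /table_val.
under eq_bigr do under eq_bigr do rewrite scalerBr.
under eq_bigr do rewrite sumrB.
rewrite sumrB exchange_big /=; apply/eqP; rewrite subr_eq0; apply/eqP.
by apply: eq_bigr => u _; apply: eq_bigr => v _; rewrite mulrC.
Qed.

Lemma gbas_sum (x : g) : x = \sum_b x b *: gbas b.
Proof.
apply/ffunP => c; rewrite sum_ffunE (bigD1 c) //= big1 => [|b nb].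
  by rewrite !ffunE eqxx addr0 [_ *: _]mulr1.
by rewrite !ffunE eq_sym (negPf nb) [_ *: _]mulr0.
Qed.

Lemma linear_gbas0 (h : g -> g) :
  linear h -> (forall b, h (gbas b) = 0) -> forall x, h x = 0.
Proof.
move=> hl h0 x; rewrite (gbas_sum x).
elim/big_rec: _ => [|b y _ hy]; last by rewrite hl h0 hy scaler0 addr0.
by have := hl (-1) 0 0; rewrite scaler0 addr0 scaleN1r addNr.
Qed.

Definition lie (x y : g) : g := table_cochain lie_table x y.

Definition d1 (f : 'End(g)) (x y : g) : g :=
  lie x (f y) - lie y (f x) - f (lie x y).

Definition d2 (phi : cochain2 F) (x y z : g) : g :=
  lie x (phi y z) - lie y (phi x z) + lie z (phi x y)
  - phi (lie x y) z + phi (lie x z) y - phi (lie y z) x.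

Fact d1_linear x y : linear (fun f => d1 f x y).
Proof.
move=> a f h; rewrite /d1 /lie !(add_lfunE, scale_lfunE) !linearP.
by apply/ffunP => w; rewrite !ffunE /=; ring.
Qed.

Fact d2_linear x y z : linear (fun phi => d2 phi x y z).
Proof.
move=> a f h; rewrite /d2 /lie !(add_lfunE, scale_lfunE) !linearP.
by apply/ffunP => w; rewrite !ffunE /=; ring.
Qed.

Fact d2_linear1 phi y z : linear (fun x => d2 phi x y z).
Proof.
move=> a u v; rewrite /d2 /lie; do !rewrite linearP ?(add_lfunE, scale_lfunE) /=.
by apply/ffunP => w; rewrite !ffunE /=; ring.
Qed.

Fact d2_linear2 phi x z : linear (fun y => d2 phi x y z).
Proof.
move=> a u v; rewrite /d2 /lie; do !rewrite linearP ?(add_lfunE, scale_lfunE) /=.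
by apply/ffunP => w; rewrite !ffunE /=; ring.
Qed.

Fact d2_linear3 phi x y : linear (fun z => d2 phi x y z).
Proof.
move=> a u v; rewrite /d2 /lie; do !rewrite linearP ?(add_lfunE, scale_lfunE) /=.
by apply/ffunP => w; rewrite !ffunE /=; ring.
Qed.

Definition jac (x y z : g) : g :=
  lie x (lie y z) + lie y (lie z x) + lie z (lie x y).

Fact jac_linear y z : linear (fun x => jac x y z).
Proof.
move=> a u v; rewrite /jac /lie; do !rewrite linearP ?(add_lfunE, scale_lfunE) /=.
by apply/ffunP => w; rewrite !ffunE /=; ring.
Qed.

Fact jac_rot x y z : jac x y z = jac y z x.
Proof. by rewrite /jac -addrA addrC. Qed.

(* Formal integer combinations of basis elements, so that trilinear identities
   can be checked on the basis by computation. *)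
Definition fsem (p : seq (int * gbasis)) : g :=
  \sum_(m <- p) m.1%:~R *: gbas m.2.

Definition ftab (t : gtable) u v : seq (int * gbasis) :=
  oapp (fun b => [:: (1 : int, b)]) [::] (t u v) ++
  oapp (fun b => [:: (-1 : int, b)]) [::] (t v u).

Definition fscale (c : int) (p : seq (int * gbasis)) :=
  [seq (c * m.1, m.2) | m <- p].

Definition fmap_tab t (p q : seq (int * gbasis)) : seq (int * gbasis) :=
  flatten [seq flatten [seq fscale (m.1 * n.1) (ftab t m.2 n.2) | n <- q] | m <- p].

Definition fcoef (p : seq (int * gbasis)) b : int :=
  foldr (fun m s => if m.2 == b then m.1 + s else s) 0 p.

Lemma fsem_cat p q : fsem (p ++ q) = fsem p + fsem q.
Proof. by rewrite /fsem big_cat. Qed.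

Lemma fsem_scale c p : fsem (fscale c p) = c%:~R *: fsem p.
Proof.
rewrite /fsem big_map scaler_sumr; apply: eq_bigr => m _.
by rewrite intrM scalerA.
Qed.

Lemma fsem_tab t u v : fsem (ftab t u v) = table_val t u v.
Proof.
rewrite /ftab fsem_cat /table_val /gbaso; congr (_ + _).
  by case: (t u v) => [b|] /=; rewrite /fsem ?big_nil // big_seq1 scale1r.
case: (t v u) => [b|] /=; rewrite /fsem ?big_nil ?oppr0 // big_seq1 /=.
by rewrite scaleN1r.
Qed.

Lemma fsem_map_tab t p q :
  fsem (fmap_tab t p q) = table_cochain t (fsem p) (fsem q).
Proof.
rewrite /fmap_tab; elim: p => [|m p IH] /=.
  by rewrite {1 2}/fsem !big_nil linear0 zero_lfunE.
rewrite fsem_cat IH [fsem (m :: p)]/fsem big_cons -/(fsem p).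
rewrite linearD add_lfunE; congr (_ + _); elim: q {IH} => [|n q IH] /=.
  by rewrite {1 2}/fsem !big_nil linear0.
rewrite fsem_cat IH [fsem (n :: q)]/fsem big_cons -/(fsem q).
rewrite [RHS]linearD; congr (_ + _).
rewrite fsem_scale fsem_tab -table_cochain_bas intrM linearZ /=.
by rewrite [in RHS]linearZ scale_lfunE scalerA [in RHS]mulrC.
Qed.

Lemma fsem_coef p : fsem p = \sum_b (fcoef p b)%:~R *: gbas b.
Proof.
elim: p => [|m p IH] /=.
  by rewrite /fsem big_nil big1 // => b _; rewrite scale0r.
rewrite /fsem big_cons -/(fsem p) IH [in RHS](bigD1 m.2) //= eqxx.
rewrite [in LHS](bigD1 m.2) //= addrA intrD scalerDl; congr (_ + _).
by apply: eq_bigr => b; rewrite eq_sym => /negPf ->.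
Qed.

Lemma fsem0 p : all (fun b => fcoef p b == 0) gbasis_enum -> fsem p = 0.
Proof.
move=> /allP p0; rewrite fsem_coef big1 // => b _.
by rewrite (eqP (p0 b _)) ?scale0r //; case: b.
Qed.

Definition fbas b : seq (int * gbasis) := [:: (1, b)].
Lemma fsem_bas b : fsem (fbas b) = gbas b.
Proof. by rewrite /fsem big_seq1 scale1r. Qed.

Definition fjac u v w :=
  let l := fmap_tab lie_table in
  let: (x, y, z) := (fbas u, fbas v, fbas w) in
  l x (l y z) ++ l y (l z x) ++ l z (l x y).

Definition fd2 t u v w :=
  let l := fmap_tab lie_table in let f := fmap_tab t in
  let: (x, y, z) := (fbas u, fbas v, fbas w) in
  l x (f y z) ++ fscale (-1) (l y (f x z)) ++ l z (f x y) ++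
  fscale (-1) (f (l x y) z) ++ f (l x z) y ++ fscale (-1) (f (l y z) x).

Definition fall0 (h : gbasis -> gbasis -> gbasis -> seq (int * gbasis)) :=
  all (fun u => all (fun v => all (fun w =>
    all (fun b => fcoef (h u v w) b == 0) gbasis_enum)
    gbasis_enum) gbasis_enum) gbasis_enum.

Lemma fall0P h : fall0 h -> forall u v w, fsem (h u v w) = 0.
Proof.
have mem b : b \in gbasis_enum by case: b.
move=> /allP hh u v w; apply: fsem0.
by have /allP/(_ v (mem v))/allP/(_ w (mem w)) := hh u (mem u).
Qed.

Lemma jac0 x y z : jac x y z = 0.
Proof.
have jb : fall0 fjac by vm_compute.
have jacb u v w : jac (gbas u) (gbas v) (gbas w) = 0.
  rewrite -(fall0P jb u v w) /fjac; cbv beta zeta iota.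
  rewrite !(fsem_cat, fsem_map_tab, fsem_bas).
  by rewrite /jac /lie !addrA.
move: x; apply: linear_gbas0 => [|u]; first exact: jac_linear.
rewrite jac_rot; move: y; apply: linear_gbas0 => [|v]; first exact: jac_linear.
rewrite jac_rot; move: z; apply: linear_gbas0 => [|w]; first exact: jac_linear.
by rewrite jac_rot.
Qed.

Lemma d2_psi i x y z : d2 (table_cochain (psi_table i)) x y z = 0.
Proof.
have jb : fall0 (fd2 (psi_table i)).
  by case: i => [[|[|[|//]]] lti]; vm_compute.
have db u v w : d2 (table_cochain (psi_table i)) (gbas u) (gbas v) (gbas w) = 0.
  rewrite -(fall0P jb u v w) /fd2; cbv beta zeta iota.
  rewrite !(fsem_cat, fsem_scale, fsem_map_tab, fsem_bas) /d2 /lie.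
  by rewrite !scaleN1r !addrA.
move: x; apply: linear_gbas0 => [|u]; first exact: d2_linear1.
move: y; apply: linear_gbas0 => [|v]; first exact: d2_linear2.
move: z; apply: linear_gbas0 => [|w]; first exact: d2_linear3.
exact: db.
Qed.

Lemma lieC x y : lie x y = - lie y x.
Proof. exact: table_cochainC. Qed.

Lemma liexx x : lie x x = 0.
Proof. exact: table_cochainxx. Qed.

Lemma lie_jacobi x y z :
  lie x (lie y z) + lie y (lie z x) + lie z (lie x y) = 0.
Proof. exact: jac0. Qed.

Definition grade (j : nat) : {vspace g} :=
  <<[seq gbas b | b <- gbasis_enum & gdeg b == j]>>%VS.

Lemma mem_grade j (x : g) :
  reflect (forall b, gdeg b != j -> x b = 0) (x \in grade j).
Proof.
apply: (iffP idP) => [|x0].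
  rewrite /grade -[X in <<X>>%VS]in_tupleE => /coord_span -> b bj.
  rewrite sum_ffunE big1 // => i _; rewrite !ffunE.
  set X := in_tuple _; have: X`_i \in X by rewrite mem_nth.
  move=> /mapP[c]; rewrite mem_filter => /andP[/eqP cj _] ->.
  rewrite ffunE; case: (eqVneq b c) bj => [->|_ _]; first by rewrite cj eqxx.
  by rewrite [LHS]mulr0.
rewrite (gbas_sum x); apply: memv_suml => b _.
have [bj|/x0->] := eqVneq (gdeg b) j; last by rewrite scale0r mem0v.
apply/memvZ/memv_span/mapP; exists b => //; rewrite mem_filter bj eqxx /=.
by case: b {bj}.
Qed.

Definition derived : {vspace g} := (\sum_(2 <= j < 7) grade j)%VS.

Definition deg0_1 (f : 'End(g)) :=
  forall i x, x \in grade i -> f x \in grade i.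

Definition deg0_2 (phi : cochain2 F) :=
  forall i j x y, x \in grade i -> y \in grade j -> phi x y \in grade (i + j).

Definition is_cocycle0 (phi : cochain2 F) :=
  [/\ forall x, phi x x = 0, deg0_2 phi & forall x y z, d2 phi x y z = 0].

Lemma table_deg t : (forall u v b, t u v = Some b -> gdeg b = gdeg u + gdeg v)%N ->
  deg0_2 (table_cochain t).
Proof.
move=> tdeg i j x y /mem_grade xi /mem_grade yj.
apply/mem_grade => w wij; rewrite table_cochainE sum_ffunE big1 // => u _.
rewrite sum_ffunE big1 // => v _; rewrite ffunE.
have [ui|/xi->] := eqVneq (gdeg u) i; last by rewrite mul0r [LHS]mul0r.
have [vj|/yj->] := eqVneq (gdeg v) j; last by rewrite mulr0 [LHS]mul0r.
rewrite [table_val _ _ _ _](_ : _ = 0) ?[LHS]mulr0 // /table_val.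
have b0 u' v' : (gdeg u' + gdeg v' = i + j)%N -> gbaso (t u' v') w = 0.
  move=> uv; case tE: (t u' v') => [b|] /=; last by rewrite ffunE.
  rewrite ffunE; case: (eqVneq w b) wij => // ->.
  by rewrite (tdeg _ _ _ tE) uv eqxx.
by rewrite !ffunE !b0 ?subrr // ?ui ?vj // addnC.
Qed.

Lemma lie_deg i j x y :
  x \in grade i -> y \in grade j -> lie x y \in grade (i + j).
Proof. by apply: table_deg => u v b; case: u; case: v => //= -[<-]. Qed.

Lemma bilinear_cochain (h : g -> g -> g) :
  (forall x, linear (h x)) -> (forall y, linear (h^~ y)) ->
  exists phi : cochain2 F, forall x y, phi x y = h x y.
Proof.
move=> hr hl.
pose hx x : {linear g -> g} :=
  HB.pack (h x) (GRing.isLinear.Build F g g *:%R (h x) (hr x)).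
have hh_lin : linear (fun x => linfun (hx x) : 'Hom(g, g)).
  by move=> a x y; apply/lfunP => z; rewrite add_lfunE scale_lfunE !lfunE /= hl.
pose hh : {linear g -> 'Hom(g, g)} :=
  HB.pack (fun x => linfun (hx x) : 'Hom(g, g))
    (GRing.isLinear.Build F g 'Hom(g, g) *:%R _ hh_lin).
by exists (linfun hh) => x y; rewrite !lfunE.
Qed.

Fact is_cocycle0_submod : submodule is_cocycle0.
Proof.
split=> [|a f h [f1 f2 f3] [h1 h2 h3]].
  have d20 := d2_linear _ _ _ (-1) (0 : cochain2 F) 0.
  split=> [x|i j x y _ _|x y z]; rewrite ?zero_lfunE ?zero_lfunE ?mem0v //.
  by have := d20 x y z; rewrite scaler0 addr0 scaleN1r addNr.
split=> [x|i j x y xi yj|x y z]; last by rewrite d2_linear f3 h3 scaler0 addr0.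
  by rewrite !(add_lfunE, scale_lfunE) f1 h1 scaler0 addr0.
by rewrite !(add_lfunE, scale_lfunE) memvD ?memvZ ?f2 ?h2.
Qed.

Definition Z20 : {vspace cochain2 F} := vspace_of is_cocycle0_submod.

Definition is_coboundary0 (phi : subvs_of Z20) :=
  exists2 f : 'End(g), deg0_1 f & forall x y, vsval phi x y = d1 f x y.

Fact is_coboundary0_submod : submodule is_coboundary0.
Proof.
split=> [|a p q [f f1 f2] [h h1 h2]].
  exists 0 => [i x _|x y]; rewrite ?zero_lfunE ?mem0v //.
  have := d1_linear x y (-1) (0 : 'End(g)) 0.
  by rewrite scaler0 addr0 scaleN1r addNr.
exists (a *: f + h) => [i x xi|x y].
  by rewrite !(add_lfunE, scale_lfunE) memvD ?memvZ ?f1 ?h1.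
by rewrite (linearP (@vsval _ _ Z20)) !(add_lfunE, scale_lfunE) d1_linear f2 h2.
Qed.

Definition B20 : {vspace subvs_of Z20} := vspace_of is_coboundary0_submod.

Lemma coboundary_cocycle (f : 'End(g)) : deg0_1 f ->
  exists phi : subvs_of Z20, forall x y, vsval phi x y = d1 f x y.
Proof.
move=> f0.
have [|y|phi phiE] := @bilinear_cochain (d1 f).
- by move=> x a u v; rewrite /d1 /lie; do !rewrite linearP ?(add_lfunE, scale_lfunE) /=;
    apply/ffunP => w; rewrite !ffunE /=; ring.
- by move=> a u v; rewrite /d1 /lie; do !rewrite linearP ?(add_lfunE, scale_lfunE) /=;
    apply/ffunP => w; rewrite !ffunE /=; ring.
suff phiZ : phi \in Z20 by exists (Subvs phiZ).
apply/mem_vspace_of; split=> [x|i j x y xi yj|x y z].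
- by rewrite phiE /d1 [lie x x]liexx linear0 subr0 subrr.
- rewrite phiE /d1; apply: memvB; last by apply: f0; exact: lie_deg.
  by apply: memvB; [|rewrite addnC]; apply: lie_deg => //; exact: f0.
have lieBr u v w : lie u (v - w) = lie u v - lie u w by exact: linearB.
have lieJ u v w : lie (lie u v) w = lie u (lie v w) - lie v (lie u w).
  have := lie_jacobi u v w; rewrite [lie w (lie u v)]lieC [lie w u]lieC.
  rewrite [lie v (- _)]linearN => /eqP; rewrite subr_eq0 => /eqP <-.
  by [].
rewrite /d2 !phiE /d1 !lieBr.
have f0z : f (lie (lie x y) z) - f (lie (lie x z) y) + f (lie (lie y z) x) = 0.
  rewrite -linearB -linearD -[RHS](linear0 f); congr (f _).
  rewrite !lieJ [lie z y]lieC [lie z x]lieC [lie y x]lieC.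
  have lieNr u v : lie u (- v) = - lie u v by exact: linearN.
  have := lie_jacobi x y z; rewrite [lie z x]lieC lieNr => J.
  rewrite -[RHS]addr0 -{1}J -J.
  by rewrite !lieNr; apply/ffunP => w; rewrite !ffunE /=; ring.
apply: etrans f0z; rewrite ![lie (lie _ _) (f _)]lieJ.
by apply/ffunP => w; rewrite !ffunE /=; ring.
Qed.

Definition H20 : vectType F := quotv B20.

Definition class20 (phi : subvs_of Z20) : H20 := qproj B20 phi.

Fact psi_cocycle i : table_cochain (psi_table i) \in Z20.
Proof.
apply/mem_vspace_of; split=> [x|j k x y xj yk|x y z]; last exact: d2_psi.
  exact: table_cochainxx.
apply: table_deg xj yk => u v b.
by case: i => [[|[|[|//]]] lti]; case: u; case: v => //= -[<-].
Qed.

Definition psi (i : 'I_3) : subvs_of Z20 := Subvs (psi_cocycle i).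

Definition pencil : {vspace H20} :=
  <<[seq class20 (psi i) | i <- enum 'I_3]>>%VS.

Local Notation L j := (subvs_of (grade j)).

Definition is_alt33 (f : 'Hom(L 3, 'Hom(L 3, L 6))) := forall x, f x x = 0.

Fact is_alt33_submod : submodule is_alt33.
Proof.
split=> [x|a f h fP hP x]; first by rewrite !zero_lfunE.
by rewrite !(add_lfunE, scale_lfunE) fP hP scaler0 addr0.
Qed.

(* Hom(L_2 (x) L_4, L_6) as bilinear maps, Hom(Lambda^2 L_3, L_6) as
   alternating ones. *)
Definition Etop : vectType F :=
  ('Hom(L 2, 'Hom(L 4, L 6)) * subvs_of (vspace_of is_alt33_submod))%type.

Definition terminal_restriction (phi : subvs_of Z20) (e : Etop) :=
  (forall (u : L 2) (v : L 4),
     vsval (e.1 u v) = vsval phi (vsval u) (vsval v)) /\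
  (forall u v : L 3,
     vsval (vsval e.2 u v) = vsval phi (vsval u) (vsval v)).

Definition metabelian_defect (phi : subvs_of Z20) (u v : subvs_of derived) : g :=
  vsval phi (vsval u) (vsval v).

End LieAlgebra.

(* Main.v *)
(* Restricted to the terminal layers, the cocycle equation on (X, u, v) and
   (Y, u, v) with u in L_2 and v in L_3 determines [X, phi(u, v)] and
   [Y, phi(u, v)], hence phi(u, v), since no nonzero element of L_5 commutes
   with X and Y: a cocycle that vanishes on the terminal components vanishes on
   all pairs of the derived algebra. Such a cocycle only moves the actions of X
   and Y on the cyclic module generated by Z_0. Gauging along a spanning tree of
   monomials leaves three values in L_6, at x^2y^2, xy^3 and y^4, i.e. an
   infinitesimal motion of the three quartic relations; these six dimensions are
   filled by P together with the gl_2-directions x d/dx, y d/dx, x d/dy (the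
   Euler direction acts trivially). Conversely each of the eight terminal
   components extends to an explicit integral cocycle. *)
From HB Require Import structures.
Require Import Defs.
From mathcomp Require Import all_boot all_order all_algebra.
From mathcomp Require Import boolp ring.

Set Implicit Arguments.
Unset Strict Implicit.
Unset Printing Implicit Defensive.

Import GRing.Theory.
Local Open Scope ring_scope.

(** * Bilinear maps between arbitrary spaces, and pairs of them *)

Lemma bilinear_hom (F : fieldType) (U V W : vectType F) (h : U -> V -> W) :
  (forall x, linear (h x)) -> (forall y, linear (h^~ y)) ->
  exists f : 'Hom(U, 'Hom(V, W)), forall x y, f x y = h x y.
Proof.
move=> hr hl.
pose hx x : {linear V -> W} :=
  HB.pack (h x) (GRing.isLinear.Build F V W *:%R (h x) (hr x)).
have hh_lin : linear (fun x => linfun (hx x) : 'Hom(V, W)).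
  by move=> a x y; apply/lfunP => z; rewrite add_lfunE scale_lfunE !lfunE /= hl.
pose hh : {linear U -> 'Hom(V, W)} :=
  HB.pack (fun x => linfun (hx x) : 'Hom(V, W))
    (GRing.isLinear.Build F U 'Hom(V, W) *:%R _ hh_lin).
by exists (linfun hh) => x y; rewrite !lfunE.
Qed.

(* Needed as abstract rewrite rules: simplifying projections of the concrete
   [Etop] unfolds its whole vector space structure. *)
Lemma fst_lin (F : fieldType) (A B : lmodType F) a (p q : A * B) :
  (a *: p + q).1 = a *: p.1 + q.1.
Proof. by []. Qed.

Lemma snd_lin (F : fieldType) (A B : lmodType F) a (p q : A * B) :
  (a *: p + q).2 = a *: p.2 + q.2.
Proof. by []. Qed.

Lemma fst_0 (A B : nmodType) : (0 : A * B).1 = 0.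
Proof. by []. Qed.

Lemma snd_0 (A B : nmodType) : (0 : A * B).2 = 0.
Proof. by []. Qed.

Lemma vsval_lfun2_0 (F : fieldType) (A B C : vectType F) (W : {vspace C})
    (u : A) (v : B) :
  vsval ((0 : 'Hom(A, 'Hom(B, subvs_of W))) u v) = 0.
Proof. by rewrite !zero_lfunE linear0. Qed.

Lemma lfun2_linear (F : fieldType) (A B C : vectType F) a
    (f h : 'Hom(A, 'Hom(B, C))) u v :
  (a *: f + h) u v = a *: f u v + h u v.
Proof. by rewrite !(add_lfunE, scale_lfunE). Qed.

(** * Cochains and endomorphisms in terms of the graded basis *)

Section Cochains.
Variable F : fieldType.
Local Notation g := (gcirc F).
Local Notation e := (gbas F).
Implicit Types (phi : cochain2 F) (x y : g).

Lemma gbas_grade b : e b \in grade F (gdeg b).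
Proof.
by apply/mem_grade => c; rewrite ffunE; case: (eqVneq c b) => // ->; rewrite eqxx.
Qed.

Lemma grade_gt6 j x : (6 < j)%N -> x \in grade F j -> x = 0.
Proof.
move=> j6 /mem_grade x0; apply/ffunP => b; rewrite x0 ?ffunE //.
by rewrite neq_ltn (leq_ltn_trans _ j6) //; case: b.
Qed.

Lemma cochain_expand phi x y :
  phi x y = \sum_u \sum_v (x u * y v) *: phi (e u) (e v).
Proof.
rewrite {1}(gbas_sum x) linear_sum sum_lfunE; apply: eq_bigr => u _.
rewrite linearZ scale_lfunE {1}(gbas_sum y) linear_sum scaler_sumr.
by apply: eq_bigr => v _; rewrite linearZ scalerA.
Qed.

Lemma lie_bas u v : lie (e u) (e v) = table_val F lie_table u v.
Proof. exact: table_cochain_bas. Qed.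

Lemma basis_endo (fb : gbasis -> g) :
  exists f : 'End(g), forall b, f (e b) = fb b.
Proof.
have l : linear (fun x : g => \sum_b x b *: fb b).
  move=> a x y; rewrite scaler_sumr -big_split; apply: eq_bigr => b _ /=.
  by rewrite scalerA -scalerDl !ffunE.
pose h : {linear g -> g} := HB.pack (fun x : g => \sum_b x b *: fb b)
  (GRing.isLinear.Build F g g *:%R _ l).
exists (linfun h) => b; rewrite lfunE /= (bigD1 b) //= ffunE eqxx scale1r.
by rewrite big1 ?addr0 // => c nc; rewrite ffunE (negPf nc) scale0r.
Qed.

Lemma deg0_1_basis (f : 'End(g)) :
  (forall b, f (e b) \in grade F (gdeg b)) -> deg0_1 f.
Proof.
move=> fd i x /mem_grade x0; rewrite (gbas_sum x) linear_sum.
apply: memv_suml => b _; rewrite linearZ /=.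
have [<-|/x0->] := eqVneq (gdeg b) i; first exact/memvZ/fd.
by rewrite scale0r mem0v.
Qed.


(** * Gauge fixing along a spanning tree *)

(* A spanning tree: among the brackets with value [b], the gauge is fixed on
   [parent b]. *)
Definition parent (b : gbasis) : option (gbasis * gbasis) :=
  match b with
  | gX | gY => None
  | gZ0 => Some (gX, gY) | gZx => Some (gX, gZ0) | gZy => Some (gY, gZ0)
  | gZx2 => Some (gX, gZx) | gZxy => Some (gX, gZy) | gZy2 => Some (gY, gZy)
  | gZx3 => Some (gX, gZx2) | gZx2y => Some (gX, gZxy)
  | gZxy2 => Some (gX, gZy2) | gZy3 => Some (gY, gZy2)
  | gT0 => Some (gX, gZx3) | gT1 => Some (gX, gZx2y)
  end.

Lemma parentP b u v : parent b = Some (u, v) ->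
  [/\ parent u = None, gdeg u = 1%N, gdeg b = (gdeg v).+1
    & table_val F lie_table u v = e b].
Proof. by case: b => //= -[<- <-]; split; rewrite // /table_val /gbaso /= subr0. Qed.

(** With [f] zero on X and Y, the equation phi(u, v) = [u, f v] - f [u, v] at a tree edge u, v with
    value b reads f b = [u, f v] - phi(u, v). Each basis element of degree at least 2 has one parent
    edge, so this defines [f] by recursion on the degree. *)
Lemma tree_gauge phi : deg0_2 phi ->
  exists2 f : 'End(g), deg0_1 f & forall b u v, parent b = Some (u, v) ->
    phi (e u) (e v) = d1 f (e u) (e v).
Proof.
move=> phid.
pose step u v z := lie (e u) z - phi (e u) (e v).
(* The recursion through [parent] is not structural, hence the fuel [n]. By [fbS] the value at [b]
   is stable once [n] reaches the degree of [b], so fuel 6 suffices everywhere. *)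
pose fb := fix fb (n : nat) (b : gbasis) {struct n} : g := if n is n'.+1 then
  if parent b is Some (u, v) then step u v (fb n' v) else 0 else 0.
have fbS n b : (gdeg b <= n)%N -> fb n.+1 b = fb n b.
  elim: n b => [|n IH] b; first by case: b.
  move=> bn; rewrite [LHS]/= [RHS]/=; case pb: (parent b) => [[u v]|//].
  have [_ _ bv _] := parentP pb; rewrite bv ltnS in bn.
  by congr (step _ _ _); apply: IH.
have [f fE] := basis_endo (fb 6).
have fstep b u v : parent b = Some (u, v) -> f (e b) = step u v (f (e v)).
  move=> pb; rewrite !fE -fbS; first by rewrite [LHS]/= pb.
  by case: (b).
have fd n b : fb n b \in grade F (gdeg b).
  elim: n b => [|n IH] b; first exact: mem0v.
  rewrite /=; case pb: (parent b) => [[u v]|]; last exact: mem0v.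
  have [_ u1 bv _] := parentP pb; rewrite bv -add1n -u1 /step memvB //.
    exact: lie_deg (gbas_grade u) (IH v).
  by apply: phid; apply: gbas_grade.
exists f => [|b u v pb]; first by apply: deg0_1_basis => b; rewrite fE fd.
have [pu _ _ uv] := parentP pb.
have fu : f (e u) = 0 by rewrite fE /= pu.
rewrite /d1 lie_bas uv (fstep _ _ _ pb) fu [lie (e v) 0]linear0 subr0.
by rewrite opprB addrC subrK.
Qed.

(** * Vanishing on the derived algebra *)

Lemma cochain_vanish (P Q : pred gbasis) phi x y :
  (forall u v, P u -> Q v -> phi (e u) (e v) = 0) ->
  (forall u, ~~ P u -> x u = 0) -> (forall v, ~~ Q v -> y v = 0) ->
  phi x y = 0.
Proof.
move=> phi0 x0 y0; rewrite cochain_expand big1 // => u _; rewrite big1 // => v _.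
have [Pu|/x0->] := boolP (P u); last by rewrite mul0r scale0r.
have [Qv|/y0->] := boolP (Q v); last by rewrite mulr0 scale0r.
by rewrite phi0 // scaler0.
Qed.

Lemma lie_derived i j x y : (1 < i)%N -> (1 < j)%N ->
  x \in grade F i -> y \in grade F j -> lie x y = 0.
Proof.
move=> i1 j1 /mem_grade x0 /mem_grade y0.
apply: (cochain_vanish (P := fun b => (1 < gdeg b)%N) (Q := fun b => (1 < gdeg b)%N)).
- move=> u v u1 v1; rewrite table_cochain_bas /table_val.
  by case: u u1; case: v v1 => //=; rewrite subrr.
- by move=> u ni; apply: x0; apply: contraNneq ni => ->.
- by move=> u nj; apply: y0; apply: contraNneq nj => ->.
Qed.

(** Since [f] preserves degrees, every term of [d1 f] contains a bracket inside the abelian derived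
    algebra. Hence terminal values and metabelian defects depend on the class alone. *)
Lemma d1_derived (f : 'End(g)) i j x y : deg0_1 f -> (1 < i)%N -> (1 < j)%N ->
  x \in grade F i -> y \in grade F j -> d1 f x y = 0.
Proof.
move=> fd i1 j1 xi yj; rewrite /d1 (lie_derived i1 j1 xi (fd _ _ yj)).
by rewrite (lie_derived j1 i1 yj (fd _ _ xi)) (lie_derived i1 j1 xi yj)
  (linear0 f) !subr0.
Qed.

Lemma psi_derived i u v : (1 < gdeg u)%N -> (1 < gdeg v)%N ->
  table_val F (psi_table i) u v = 0.
Proof.
case: i => [[|[|[|//]]] lti]; case: u => // _; case: v => // _;
  by rewrite /table_val /= subrr.
Qed.

Lemma alternating_anti phi : (forall x, phi x x = 0) ->
  forall x y, phi x y = - phi y x.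
Proof.
move=> alt x y; apply/eqP; rewrite -addr_eq0; have := alt (x + y).
by do !rewrite linearD ?add_lfunE /=; rewrite !alt add0r addr0 addrC => ->.
Qed.

(** * From the terminal layers to the whole metabelian defect *)

(** In the coordinates a, b, c, d of [v] at x^3, x^2y, xy^2, y^3, bracketing with X gives a T_0 + (b
    + d) T_1 and with Y gives d T_0 + (a + c) T_1. These four forms are independent. *)
Lemma lieXY_inj v : v \in grade F 5 ->
  lie (e gX) v = 0 -> lie (e gY) v = 0 -> v = 0.
Proof.
have scaleE (a b : F^o) : a *: b = a * b by [].
move=> /mem_grade v5.
have -> : v = v gZx3 *: e gZx3 + v gZx2y *: e gZx2y + v gZxy2 *: e gZxy2
              + v gZy3 *: e gZy3.
  apply/ffunP => b; rewrite !ffunE !scaleE.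
  by case: b; rewrite /= ?(mulr0, mulr1, addr0, add0r) // v5.
have lieE u : lie (e u) = table_cochain F lie_table (e u) by [].
rewrite !lieE !linearD !linearZ /= !table_cochain_bas /table_val /gbaso /=.
move=> /ffunP hX /ffunP hY.
have := hX gT0; have := hX gT1; have := hY gT0; have := hY gT1.
rewrite !ffunE /= !scaleE ?(subr0, mulr0, mulr1, addr0, add0r).
move=> hxy y0; rewrite y0 addr0 => x1 x0; rewrite x0 add0r in hxy.
by rewrite x0 x1 hxy !scale0r !addr0.
Qed.

Definition metabelian phi := forall i j x y, (1 < i)%N -> (1 < j)%N ->
  x \in grade F i -> y \in grade F j -> phi x y = 0.

(** The letters are the six summands of [d2] in order; this lemma and the next isolate the first and
    the fifth of them in a cocycle equation. *)
Lemma d2_solve1 (a b c d p q : g) : a - b + c - d + p - q = 0 ->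
  b = 0 -> c = 0 -> d = 0 -> p = 0 -> q = 0 -> a = 0.
Proof. by move=> h b0 c0 d0 p0 q0; move: h; rewrite b0 c0 d0 p0 q0 !(subr0, addr0). Qed.

Lemma d2_solve5 (a b c d p q : g) : a - b + c - d + p - q = 0 ->
  a = 0 -> b = 0 -> c = 0 -> d = 0 -> q = 0 -> p = 0.
Proof. by move=> h a0 b0 c0 d0 q0; move: h; rewrite a0 b0 c0 d0 q0 !(subr0, add0r). Qed.

Lemma terminal_metabelian phi : is_cocycle0 phi ->
  (forall x y, x \in grade F 2 -> y \in grade F 4 -> phi x y = 0) ->
  (forall x y, x \in grade F 3 -> y \in grade F 3 -> phi x y = 0) ->
  metabelian phi.
Proof.
move=> [alt phid coc] h24 h33; have anti := alternating_anti alt.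
(* L_2 is a line, so alternation suffices. *)
have h22 x y : x \in grade F 2 -> y \in grade F 2 -> phi x y = 0.
  move=> /mem_grade x0 /mem_grade y0.
  apply: (cochain_vanish (P := fun b => gdeg b == 2) (Q := fun b => gdeg b == 2)) => //.
  by case=> // -[] // _ _; apply: alt.
(* In the cocycle equation on (u, x, y), the two other outer brackets lie in [L_2, L_4] and
   [L_3, L_3], two inner terms are terminal values, and the last contains [x, y] = 0. *)
have lie0 u x y : u \in grade F 1 -> x \in grade F 2 -> y \in grade F 3 ->
    lie u (phi x y) = 0.
  move=> u1 x2 y3; apply: d2_solve1 (coc u x y) _ _ _ _ _.
  - exact: (lie_derived (i := 2) (j := 4) isT isT x2 (phid 1%N 3%N _ _ u1 y3)).
  - exact: (lie_derived (i := 3) (j := 3) isT isT y3 (phid 1%N 2%N _ _ u1 x2)).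
  - exact: (h33 _ _ (lie_deg u1 x2)).
  - by rewrite anti (h24 _ _ x2 (lie_deg u1 y3)) oppr0.
  - have xy0 : lie x y = 0 by exact: (lie_derived (i := 2) (j := 3) isT isT x2 y3).
    by rewrite xy0 linear0 zero_lfunE.
have h23 x y : x \in grade F 2 -> y \in grade F 3 -> phi x y = 0.
  move=> x2 y3; apply: lieXY_inj; first exact: (phid 2%N 3%N _ _ x2 y3).
    exact: lie0 _ _ _ (gbas_grade gX) x2 y3.
  exact: lie0 _ _ _ (gbas_grade gY) x2 y3.
move=> i j x y i1 j1 xi yj.
have [ij|] := ltnP 6 (i + j); first exact/(grade_gt6 ij)/phid.
(* Total degree at most 6 leaves the pairs (2,2), (2,3), (2,4), (3,2), (3,3) and (4,2). *)
case: i j i1 j1 xi yj => [|[|[|[|[|i]]]]] [|[|[|[|[|j]]]]] //= _ _ xi yj;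
  rewrite ?(addnS, addn0) //= => _.
- exact: h22 _ _ xi yj.
- exact: h23 _ _ xi yj.
- exact: h24 _ _ xi yj.
- by rewrite anti (h23 _ _ yj xi) oppr0.
- exact: h33 _ _ xi yj.
- by rewrite anti (h24 _ _ yj xi) oppr0.
Qed.

(** * Rigidity of gauge-fixed metabelian cocycles *)

(** The tree and the first two extra values exhaust the action of X. The values at (Y, Z_q) not
    covered by the tree or the third extra value have q divisible by x, and they follow by commuting
    the two actions. *)
Lemma cocycle_rigid phi : is_cocycle0 phi -> metabelian phi ->
  (forall b u v, parent b = Some (u, v) -> phi (e u) (e v) = 0) ->
  phi (e gX) (e gZxy2) = 0 -> phi (e gX) (e gZy3) = 0 ->
  phi (e gY) (e gZy3) = 0 -> phi = 0.
Proof.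
move=> [alt phid coc] meta tree0 Xxy2 Xy3 Yy3; have anti := alternating_anti alt.
have XY0 : phi (e gX) (e gY) = 0 by apply: (tree0 gZ0).
have high u v : (6 < gdeg u + gdeg v)%N -> phi (e u) (e v) = 0.
  by move=> uv; apply: (grade_gt6 uv); apply: phid; apply: gbas_grade.
have X0 b : (1 < gdeg b)%N -> phi (e gX) (e b) = 0.
  case: b => // _; [exact: (tree0 gZx) | exact: (tree0 gZx2) | exact: (tree0 gZxy)
    | exact: (tree0 gZx3) | exact: (tree0 gZx2y) | exact: (tree0 gZxy2)
    | exact: (tree0 gT0) | exact: (tree0 gT1) | exact: high | exact: high].
have lieuN u : lie u (0 : g) = 0 by exact: linear0.
(* Here [b], [c], [d] stand for Z_p, Z_(xp), Z_(yp). In the cocycle equation on (X, Y, Z_p) every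
   term but phi([X, Z_p], Y) vanishes. *)
have YX b c d : (1 < gdeg b)%N -> lie (e gX) (e b) = e c ->
    lie (e gY) (e b) = gbaso F d -> (if d is Some d' then 1 < gdeg d' else true)%N ->
    phi (e gY) (e b) = 0 -> phi (e gY) (e c) = 0.
  move=> b1 Xb Yb d1 Yb0; rewrite anti -Xb.
  suff -> : phi (lie (e gX) (e b)) (e gY) = 0 by rewrite oppr0.
  apply: d2_solve5 (coc (e gX) (e gY) (e b)) _ _ _ _ _.
  - by rewrite Yb0 lieuN.
  - by rewrite X0 // lieuN.
  - by rewrite XY0 lieuN.
  - have -> : lie (e gX) (e gY) = e gZ0 by rewrite lie_bas /table_val /gbaso /= subr0.
    exact: (meta 2%N (gdeg b) _ _ erefl b1 (gbas_grade gZ0) (gbas_grade b)).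
  - rewrite Yb anti; case: d d1 {Yb} => [d|] d1; first by rewrite X0 ?oppr0.
    by rewrite linear0 oppr0.
have Y0 b : (1 < gdeg b)%N -> phi (e gY) (e b) = 0.
  have liE u v w : table_val F lie_table u v = w -> lie (e u) (e v) = w.
    by move=> <-; apply: lie_bas.
  have YZ0 := tree0 gZy _ _ erefl; have YZy := tree0 gZy2 _ _ erefl.
  have YZy2 := tree0 gZy3 _ _ erefl.
  have YZx : phi (e gY) (e gZx) = 0.
    by apply: (YX gZ0 gZx (Some gZy)) => //; apply: liE; rewrite /table_val /= subr0.
  have YZx2 : phi (e gY) (e gZx2) = 0.
    by apply: (YX gZx gZx2 (Some gZxy)) => //; apply: liE; rewrite /table_val /= subr0.
  have YZxy : phi (e gY) (e gZxy) = 0.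
    by apply: (YX gZy gZxy (Some gZy2)) => //; apply: liE; rewrite /table_val /= subr0.
  have YZx3 : phi (e gY) (e gZx3) = 0.
    by apply: (YX gZx2 gZx3 (Some gZx2y)) => //; apply: liE; rewrite /table_val /= subr0.
  have YZx2y : phi (e gY) (e gZx2y) = 0.
    by apply: (YX gZxy gZx2y (Some gZxy2)) => //; apply: liE; rewrite /table_val /= subr0.
  have YZxy2 : phi (e gY) (e gZxy2) = 0.
    by apply: (YX gZy2 gZxy2 (Some gZy3)) => //; apply: liE; rewrite /table_val /= subr0.
  by case: b => // _; apply: high.
suff bas0 u v : phi (e u) (e v) = 0.
  apply/lfunP => x; apply/lfunP => y; rewrite !zero_lfunE.
  by apply: (cochain_vanish (P := predT) (Q := predT)).
have uXY w : ~~ (1 < gdeg w)%N -> w = gX \/ w = gY by case: w => //; [left|right].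
have [u1|/uXY[]->] := boolP (1 < gdeg u)%N;
  have [v1|/uXY[]->] := boolP (1 < gdeg v)%N; rewrite ?alt //.
- exact: (meta _ _ _ _ u1 v1 (gbas_grade u) (gbas_grade v)).
- by rewrite anti X0 ?oppr0.
- by rewrite anti Y0 ?oppr0.
- exact: X0.
- exact: Y0.
- by rewrite anti XY0 oppr0.
Qed.

(** * Filling the quartic relations by gl_2-directions and the pencil *)

(* [f] is the derivation X -> ga X + al Y, Y -> be X on the free part, corrected
   on T_0 and T_1 so that the pencil cocycles vanish on the tree too; al, be, ga
   and the coefficients of the pencil solve the resulting 6 x 6 system, of
   determinant a power of 2. *)
Lemma gl2_pencil (a0 a1 b0 b1 c0 c1 : F) : 2%:R != 0 :> F ->
  exists (f : 'End(g)) (p : 'I_3 -> F), deg0_1 f /\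
    let S u v := \sum_i p i *: table_cochain F (psi_table i) (e u) (e v)
                 + d1 f (e u) (e v) in
    [/\ forall b u v, parent b = Some (u, v) -> S u v = 0,
        S gX gZxy2 = a0 *: e gT0 + a1 *: e gT1,
        S gX gZy3 = b0 *: e gT0 + b1 *: e gT1
      & S gY gZy3 = c0 *: e gT0 + c1 *: e gT1].
Proof.
move=> nz2.
have nz4 : 4%:R != 0 :> F by rewrite (natrM _ 2 2) mulf_neq0.
have nz8 : 8%:R != 0 :> F by rewrite (natrM _ 2 4) mulf_neq0.
(* The T_1-coefficients give a1 = 2(al + be), b1 = -2 ga, c1 = 4(be - al); the T_0-coefficients give
   b0 = al - be - p1 and c0 = -4 ga - p0. *)
pose al := a1 / 4%:R - c1 / 8%:R; pose be := a1 / 4%:R + c1 / 8%:R.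
pose ga := - b1 / 2%:R.
pose p0 := - (4%:R * ga) - c0; pose p1 := al - be - b0.
have [f fE] := basis_endo (fun b => match b with
  | gX => ga *: e gX + al *: e gY
  | gY => be *: e gX
  | gZ0 => ga *: e gZ0
  | gZx => (2%:R * ga) *: e gZx + al *: e gZy
  | gZy => be *: e gZx + ga *: e gZy
  | gZx2 => (3%:R * ga) *: e gZx2 + (2%:R * al) *: e gZxy
  | gZxy => be *: e gZx2 + (2%:R * ga) *: e gZxy + al *: e gZy2
  | gZy2 => (2%:R * be) *: e gZxy + ga *: e gZy2
  | gZx3 => (4%:R * ga) *: e gZx3 + (3%:R * al) *: e gZx2y
  | gZx2y => be *: e gZx3 + (3%:R * ga) *: e gZx2y + (2%:R * al) *: e gZxy2
  | gZxy2 => (2%:R * be) *: e gZx2y + (2%:R * ga) *: e gZxy2 + al *: e gZy3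
  | gZy3 => (3%:R * be) *: e gZxy2 + ga *: e gZy3
  | gT0 => (5%:R * ga + p0) *: e gT0 + (4%:R * al) *: e gT1
  | gT1 => (be + p1) *: e gT0 + (4%:R * ga) *: e gT1 end).
(* The cocycle psi_2 has no value on the tree, and [f] contributes only to T_1 at (X, Z_(xy^2)), so
   the coefficient of psi_2 is [a0] itself. *)
exists f, (fun i => [:: p0; p1; a0]`_i).
have scaleE (a b : F^o) : a *: b = a * b by [].
have lieD u x y : lie (e u) (x + y) = lie (e u) x + lie (e u) y by exact: linearD.
have lieZ u k x : lie (e u) (k *: x) = k *: lie (e u) x by exact: linearZ.
split.
  apply: deg0_1_basis; case; rewrite fE /=;
    by do ?[exact: gbas_grade | apply: rpredD | apply: rpredZ].
have SE (u v : gbasis) :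
    \sum_(i < 3) [:: p0; p1; a0]`_i *: table_cochain F (psi_table i) (e u) (e v)
    + d1 f (e u) (e v) =
    p0 *: table_val F (psi_table (@Ordinal 3 0 isT)) u v
    + p1 *: table_val F (psi_table (@Ordinal 3 1 isT)) u v
    + a0 *: table_val F (psi_table (@Ordinal 3 2 isT)) u v
    + (lie (e u) (f (e v)) - lie (e v) (f (e u)) - f (table_val F lie_table u v)).
  rewrite /d1 lie_bas !big_ord_recl big_ord0 addr0 !table_cochain_bas !addrA.
  by do ?congr (_ + _).
split=> [b u v|||]; first case: b => //= -[<- <-].
all: rewrite SE !fE /table_val /gbaso /= ?(subr0, sub0r, linear0, linearN) /=
  ?fE !(lieD, lieZ) !lie_bas.
all: rewrite /table_val /gbaso /= ?(subr0, sub0r).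
all: apply/ffunP => w; rewrite !ffunE !scaleE /p1 /p0 /al /be /ga.
all: by field; rewrite ?nz2 ?nz4 ?nz8.
Qed.

(** * Cocycles with zero terminal restriction *)

Lemma cocycle20P (rho : subvs_of (Z20 F)) : is_cocycle0 (vsval rho).
Proof. by apply/(mem_vspace_of (is_cocycle0_submod F)); apply: subvsP. Qed.

Fact class20_linear : linear (@class20 F).
Proof. exact: linearP. Qed.
HB.instance Definition _ := GRing.isLinear.Build F (subvs_of (Z20 F)) (H20 F) *:%R
  (@class20 F) class20_linear.

Lemma class20_coboundary (f : 'End(g)) (rho : subvs_of (Z20 F)) : deg0_1 f ->
  (forall x y, vsval rho x y = d1 f x y) -> class20 rho = 0.
Proof.
move=> fd rhoE; rewrite -[RHS](linear0 (qproj (B20 F))); apply/eqP.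
by rewrite qproj_eq subr0; apply/mem_vspace_of; exists f.
Qed.

Lemma class20_psi i : class20 (psi F i) \in pencil F.
Proof. by apply/memv_span/map_f; rewrite mem_enum. Qed.

Lemma grade6_sum x : x \in grade F 6 -> x = x gT0 *: e gT0 + x gT1 *: e gT1.
Proof.
have scaleE (a b : F^o) : a *: b = a * b by [].
move=> /mem_grade x6; apply/ffunP => b; rewrite !ffunE !scaleE.
by case: b; rewrite /= ?(mulr0, mulr1, addr0, add0r) // x6.
Qed.

Definition terminal_zero phi :=
  (forall x y, x \in grade F 2 -> y \in grade F 4 -> phi x y = 0) /\
  (forall x y, x \in grade F 3 -> y \in grade F 3 -> phi x y = 0).

(** The coboundary [phi0] clears the tree; [psis + phi1] then matches the three remaining values
    while staying zero on the tree. The rest [tau] satisfies [cocycle_rigid], so [rho] equals [psis]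
    up to coboundaries. *)
Lemma terminal_zero_pencil (rho : subvs_of (Z20 F)) : 2%:R != 0 :> F ->
  terminal_zero (vsval rho) -> class20 rho \in pencil F.
Proof.
move=> nz2 [h24 h33].
have meta := terminal_metabelian (cocycle20P rho) h24 h33.
have [_ rhod _] := cocycle20P rho.
have [f0 f0d f0E] := tree_gauge rhod.
have [phi0 phi0E] := coboundary_cocycle f0d.
pose sig := vsval rho - vsval phi0 : cochain2 F.
have sigd x y : x \in grade F 1 -> y \in grade F 5 -> sig x y \in grade F 6.
  have [_ phi0d _] := cocycle20P phi0.
  move=> x1 y5; rewrite add_lfunE opp_lfunE add_lfunE opp_lfunE.
  exact: memvB (rhod 1%N 5%N _ _ x1 y5) (phi0d 1%N 5%N _ _ x1 y5).
have E6 u v : gdeg u = 1%N -> gdeg v = 5%N ->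
    sig (e u) (e v) = sig (e u) (e v) gT0 *: e gT0 + sig (e u) (e v) gT1 *: e gT1.
  move=> u1 v5; have := gbas_grade u; have := gbas_grade v; rewrite u1 v5 => eu ev.
  exact/grade6_sum/sigd.
have [f1 [p [f1d /= [S0 SX2 SX3 SY3]]]] := gl2_pencil
  (sig (e gX) (e gZxy2) gT0) (sig (e gX) (e gZxy2) gT1)
  (sig (e gX) (e gZy3) gT0) (sig (e gX) (e gZy3) gT1)
  (sig (e gY) (e gZy3) gT0) (sig (e gY) (e gZy3) gT1) nz2.
have [phi1 phi1E] := coboundary_cocycle f1d.
pose psis : subvs_of (Z20 F) := \sum_i p i *: psi F i.
have psisE x y : vsval psis x y = \sum_i p i *: table_cochain F (psi_table i) x y.
  rewrite linear_sum !sum_lfunE; apply: eq_bigr => i _.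
  by rewrite linearZ !scale_lfunE.
pose tau := rho - phi0 - psis - phi1.
have tauE x y : vsval tau x y =
    sig x y - (\sum_i p i *: table_cochain F (psi_table i) x y + d1 f1 x y).
  by rewrite !linearB !(add_lfunE, opp_lfunE) /= psisE phi1E -addrA -opprD.
have tau0 : vsval tau = 0.
  apply: cocycle_rigid (cocycle20P tau) _ _ _ _ _.
  - move=> i j v w i1 j1 vi wj; rewrite tauE (d1_derived f1d i1 j1 vi wj).
    rewrite /sig !(add_lfunE, opp_lfunE) (meta _ _ _ _ i1 j1 vi wj) phi0E.
    rewrite (d1_derived f0d i1 j1 vi wj) big1 ?(addr0, subr0) // => k _.
    move: vi wj => /mem_grade v0 /mem_grade w0.
    rewrite (cochain_vanish (P := fun b => gdeg b == i) (Q := fun b => gdeg b == j)).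
    + exact: scaler0.
    + by move=> a b /eqP ai /eqP bj; rewrite table_cochain_bas psi_derived ?ai ?bj.
    + by move=> a /v0.
    + by move=> a /w0.
  - move=> b u v pb; rewrite tauE (S0 _ _ _ pb) subr0 /sig.
    by rewrite !(add_lfunE, opp_lfunE) phi0E (f0E _ _ _ pb) subrr.
  - by rewrite tauE SX2 -E6 ?subrr.
  - by rewrite tauE SX3 -E6 ?subrr.
  - by rewrite tauE SY3 -E6 ?subrr.
have tauz : tau = 0.
  by apply: subvs_inj; rewrite tau0 [RHS](linear0 (@vsval _ _ (Z20 F))).
have -> : rho = phi1 + psis + phi0 by rewrite -[phi1]add0r -tauz /tau !subrK.
rewrite !linearD /=
  (class20_coboundary f0d phi0E) (class20_coboundary f1d phi1E) add0r addr0.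
rewrite linear_sum; apply: rpred_sum => i _; rewrite linearZ.
exact/rpredZ/class20_psi.
Qed.

(** * Integral cocycles dual to the terminal components *)

(** A triple (u, v, b) encodes the alternating cochain sending (e_u, e_v) to e_b. Integer
    combinations of these allow the cocycle equation to be checked by computation, uniformly in the
    field. *)
Definition entry := (gbasis * gbasis * gbasis)%type.

Definition entry_table (t : entry) : gtable :=
  fun u v => if (u == t.1.1) && (v == t.1.2) then Some t.2 else None.

Definition entry_deg (t : entry) := gdeg t.2 == (gdeg t.1.1 + gdeg t.1.2)%N.

Definition entries_cochain (s : seq (int * entry)) : cochain2 F :=
  \sum_(m <- s) m.1%:~R *: table_cochain F (entry_table m.2).

Definition fentries (h : gtable -> seq (int * gbasis)) (s : seq (int * entry)) :=
  flatten [seq fscale m.1 (h (entry_table m.2)) | m <- s].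

(** Used with [k] the value of [d2] at a basis triple, and with [k] the evaluation at a basis
    pair. *)
Lemma fsem_entries (h : gtable -> seq (int * gbasis)) (k : cochain2 F -> g) s :
  linear k -> (forall t, fsem F (h t) = k (table_cochain F t)) ->
  fsem F (fentries h s) = k (entries_cochain s).
Proof.
move=> kl hk; rewrite /entries_cochain /fentries; elim: s => [|m s IH].
  rewrite /fsem !big_nil; have := kl (-1) 0 0.
  by rewrite scaler0 addr0 scaleN1r addNr.
by rewrite /= fsem_cat fsem_scale IH hk big_cons kl.
Qed.

Lemma fsem_d2 t u v w :
  fsem F (fd2 t u v w) = d2 (table_cochain F t) (e u) (e v) (e w).
Proof.
rewrite /fd2; cbv beta zeta iota.
rewrite !(fsem_cat, fsem_scale, fsem_map_tab, fsem_bas) /d2 /lie.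
by rewrite !scaleN1r !addrA.
Qed.

Lemma fsem_at p b : fsem F p b = (fcoef p b)%:~R.
Proof.
rewrite fsem_coef sum_ffunE (bigD1 b) //= big1 => [|c nc].
  by rewrite !ffunE eqxx addr0 [LHS]mulr1.
by rewrite !ffunE eq_sym (negPf nc) [LHS]mulr0.
Qed.

(** Basis elements absent from [p] have coefficient zero anyway; skipping them keeps the check over
    all basis triples short. *)
Definition fnull (p : seq (int * gbasis)) := all (fun m => fcoef p m.2 == 0) p.

Lemma fnullP p : fnull p -> fsem F p = 0.
Proof.
move=> /allP p0; rewrite fsem_coef big1 // => b _.
have [/mapP[m mp ->]|] := boolP (b \in [seq m.2 | m <- p]).
  by rewrite (eqP (p0 m mp)) scale0r.
elim: p {p0} => [|m p IH] /=; first by rewrite scale0r.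
by rewrite inE negb_or eq_sym => /andP[/negPf -> /IH].
Qed.

Lemma entries_cocycle0 s : all (fun m => entry_deg m.2) s ->
  (forall u v w, fnull (fentries (fun t => fd2 t u v w) s)) ->
  is_cocycle0 (entries_cochain s).
Proof.
move=> sdeg s0; split.
- move=> x; rewrite /entries_cochain !sum_lfunE big1 // => m _.
  by rewrite !scale_lfunE table_cochainxx scaler0.
- move=> i j x y xi yj; rewrite /entries_cochain !sum_lfunE big_seq.
  apply: memv_suml => m ms; rewrite !scale_lfunE memvZ //.
  apply: table_deg xi yj => u v b; rewrite /entry_table.
  case: ifP => // /andP[/eqP -> /eqP ->] [<-].
  exact/eqP/(allP sdeg _ ms).
have db u v w : d2 (entries_cochain s) (e u) (e v) (e w) = 0.
  rewrite -(fnullP (s0 u v w)).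
  rewrite (fsem_entries (k := fun phi => d2 phi (e u) (e v) (e w))) //.
    by move=> a f h; apply: d2_linear.
  by move=> t; apply: fsem_d2.
move=> x y z.
move: x; apply: linear_gbas0 => [|u]; first exact: d2_linear1.
move: y; apply: linear_gbas0 => [|v]; first exact: d2_linear2.
move: z; apply: linear_gbas0 => [|w]; first exact: d2_linear3.
exact: db.
Qed.

Lemma entries_cochain_at s u v b : entries_cochain s (e u) (e v) b =
  (fcoef (fentries (fun t => ftab t u v) s) b)%:~R.
Proof.
rewrite -fsem_at (fsem_entries (k := fun phi => phi (e u) (e v))) //.
  by move=> a f h; rewrite !(add_lfunE, scale_lfunE).
by move=> t; rewrite table_cochain_bas fsem_tab.
Qed.

(** Coordinates on [Etop]: six for L_2 (x) L_4, and two for the line of Z_x, Z_y in the exterior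
    square of L_3. *)
Definition terminal_entries : seq entry :=
  [:: (gZ0, gZx2, gT0); (gZ0, gZx2, gT1); (gZ0, gZxy, gT0); (gZ0, gZxy, gT1);
      (gZ0, gZy2, gT0); (gZ0, gZy2, gT1); (gZx, gZy, gT0); (gZx, gZy, gT1)].

(* The k-th list is the solution of the cocycle equations with the k-th terminal
   component equal to 1, the other ones and all values on (Y, -) equal to 0. *)
Definition dual_entries : seq (seq (int * entry)) :=
  [:: [:: (1, (gZ0, gZx2, gT0)); (1, (gZ0, gZx, gZx3)); (-1, (gZ0, gZx, gZxy2));
          (-1, (gX, gZx2, gZy3)); (1, (gX, gZxy, gZx3)); (-1, (gX, gZxy, gZxy2))];
      [:: (1, (gZ0, gZx2, gT1)); (1, (gZ0, gZx, gZx2y)); (-1, (gX, gZx, gZx2));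
          (-1, (gX, gZx2, gZx3))];
      [:: (1, (gZ0, gZxy, gT0)); (-1, (gZ0, gZx, gZx2y)); (1, (gZ0, gZx, gZy3));
          (1, (gZ0, gZy, gZx3)); (-1, (gZ0, gZy, gZxy2)); (1, (gX, gZx, gZx2));
          (-2, (gX, gZx, gZy2)); (-1, (gX, gZxy, gZy3)); (1, (gX, gZy2, gZx3));
          (-1, (gX, gZy2, gZxy2))];
      [:: (1, (gZ0, gZxy, gT1)); (1, (gZ0, gZx, gZxy2)); (1, (gZ0, gZy, gZx2y));
          (-2, (gX, gZx, gZxy)); (-1, (gX, gZxy, gZxy2)); (1, (gX, gZy2, gZx2y))];
      [:: (1, (gZ0, gZy2, gT0)); (-1, (gZ0, gZy, gZx2y)); (1, (gZ0, gZy, gZy3));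
          (-2, (gX, gZ0, gZy)); (-2, (gX, gZy, gZy2)); (-1, (gX, gZy2, gZx2y));
          (-1, (gX, gZy2, gZy3))];
      [:: (1, (gZ0, gZy2, gT1)); (1, (gZ0, gZy, gZxy2)); (-2, (gX, gZ0, gZx));
          (-2, (gX, gZy, gZxy)); (-1, (gX, gZy2, gZxy2))];
      [:: (1, (gZx, gZy, gT0)); (1, (gZ0, gZx, gZx2y)); (-1, (gZ0, gZx, gZy3));
          (1, (gZ0, gZy, gZx3)); (-1, (gZ0, gZy, gZxy2)); (-1, (gX, gZx, gZx2));
          (1, (gX, gZx, gZy2)); (1, (gX, gZy2, gZx3)); (-1, (gX, gZy2, gZxy2))];
      [:: (1, (gZx, gZy, gT1)); (-1, (gZ0, gZx, gZxy2)); (1, (gZ0, gZy, gZx2y));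
          (1, (gX, gZx, gZxy)); (1, (gX, gZy2, gZx2y))]].

Definition tentry (k : 'I_8) : entry := nth (gX, gX, gX) terminal_entries k.

Lemma dual_cocycle0 (k : 'I_8) :
  is_cocycle0 (entries_cochain (nth [::] dual_entries k)).
Proof.
pose E := gbasis_enum.
have mem b : b \in E by case: b.
have dual_ok : all (fun s => all (fun m => entry_deg m.2) s && all (fun u =>
    all (fun v => all (fun w => fnull (fentries (fun t => fd2 t u v w) s)) E) E) E)
    dual_entries by vm_compute.
have /andP[degs /allP h] := all_nthP [::] dual_ok k (ltn_ord k).
apply: (entries_cocycle0 degs) => u v w.
by have /allP/(_ v (mem v))/allP/(_ w (mem w)) := h u (mem u).
Qed.

Lemma dual_terminal (k j : 'I_8) :
  entries_cochain (nth [::] dual_entries k)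
    (e (tentry j).1.1) (e (tentry j).1.2) (tentry j).2 = (j == k)%:R.
Proof.
rewrite entries_cochain_at.
have check : all (fun k => all (fun j => let t := nth (gX, gX, gX) terminal_entries j in
    fcoef (fentries (fun h => ftab h t.1.1 t.1.2) (nth [::] dual_entries k)) t.2
      == ((j == k) : nat)%:Z) (iota 0 8)) (iota 0 8) by vm_compute.
have /allP/(_ (k : nat)) := check; rewrite mem_iota ltn_ord => /(_ isT).
move=> /allP/(_ (j : nat)); rewrite mem_iota ltn_ord => /(_ isT) /eqP ->.
by [].
Qed.

Local Notation L j := (subvs_of (grade F j)).

Lemma dual_mem k : entries_cochain (nth [::] dual_entries (k : 'I_8)) \in Z20 F.
Proof. exact/mem_vspace_of/dual_cocycle0. Qed.

(** A linear section of terminal restriction, written in the coordinates [terminal_entries]. *)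
Definition dual_cocycle (c : 'rV[F]_8) : subvs_of (Z20 F) :=
  \sum_k c ord0 k *: Subvs (dual_mem k).

Fact dual_cocycle_linear : linear dual_cocycle.
Proof.
move=> a c c'; rewrite /dual_cocycle scaler_sumr -big_split; apply: eq_bigr => k _.
by rewrite !mxE scalerDl scalerA.
Qed.
HB.instance Definition _ := GRing.isLinear.Build F 'rV[F]_8 (subvs_of (Z20 F))
  *:%R dual_cocycle dual_cocycle_linear.

Lemma dual_cocycle_terminal c (j : 'I_8) :
  vsval (dual_cocycle c) (e (tentry j).1.1) (e (tentry j).1.2) (tentry j).2 = c ord0 j.
Proof.
rewrite linear_sum !sum_lfunE sum_ffunE (bigD1 j) // big1 => [|k kj].
  by rewrite linearZ !scale_lfunE ffunE dual_terminal eqxx [LHS]addr0 [LHS]mulr1.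
by rewrite linearZ !scale_lfunE ffunE dual_terminal eq_sym (negPf kj) [LHS]mulr0.
Qed.

(** * Terminal restriction as a linear map, and its kernel *)

Lemma terminal_restriction_ex (phi : subvs_of (Z20 F)) :
  exists E : Etop F, terminal_restriction phi E.
Proof.
have [alt phid _] := cocycle20P phi.
have bil i j : exists f : 'Hom(L i, 'Hom(L j, L 6)),
    forall u v, f u v = vsproj (grade F 6) (vsval phi (vsval u) (vsval v)).
  apply: bilinear_hom => [x a y z|y a x z]; first by rewrite !linearP.
  by rewrite linearP add_lfunE scale_lfunE linearP.
have [f fE] := bil 2%N 4%N; have [h hE] := bil 3%N 3%N.
have hA : h \in vspace_of (is_alt33_submod F).
  by apply/mem_vspace_of => x; rewrite hE alt linear0.
exists (f, Subvs hA); split=> [u v|u v] /=.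
  by rewrite fE; apply/vsprojK/(phid 2%N 4%N _ _ (subvsP u) (subvsP v)).
by rewrite hE; apply/vsprojK/(phid 3%N 3%N _ _ (subvsP u) (subvsP v)).
Qed.

(** The relation determines its second argument ([trestr_uniq]), so the choice is canonical;
    linearity follows from this uniqueness. *)
Definition trestr rho : Etop F := sval (cid (terminal_restriction_ex rho)).

Lemma trestrP rho : terminal_restriction rho (trestr rho).
Proof. by rewrite /trestr; case: cid. Qed.

Lemma trestr_uniq rho E : terminal_restriction rho E -> trestr rho = E.
Proof.
have := trestrP rho; case: (trestr rho) E => [f1 f2] [h1 h2] /= [fE1 fE2] [hE1 hE2].
congr (_, _).
  apply/lfunP => u; apply/lfunP => v; apply: subvs_inj.
  exact: etrans (fE1 u v) (esym (hE1 u v)).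
apply: subvs_inj; apply/lfunP => u; apply/lfunP => v; apply: subvs_inj.
exact: etrans (fE2 u v) (esym (hE2 u v)).
Qed.

Fact trestr_linear : linear trestr.
Proof.
move=> a rho psi; apply: trestr_uniq.
have [fE1 fE2] := trestrP rho; have [hE1 hE2] := trestrP psi.
have rhs x y : vsval (a *: rho + psi) x y = a *: vsval rho x y + vsval psi x y.
  by rewrite (linearP (@vsval _ _ (Z20 F))) add_lfunE scale_lfunE add_lfunE scale_lfunE.
split=> u v; rewrite rhs.
  rewrite -fE1 -hE1 -linearP; congr vsval.
  by rewrite fst_lin; exact: lfun2_linear.
rewrite -fE2 -hE2 -linearP; congr vsval.
rewrite snd_lin (linearP (@vsval _ _ (vspace_of (is_alt33_submod F)))).
exact: lfun2_linear.
Qed.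
HB.instance Definition _ := GRing.isLinear.Build F (subvs_of (Z20 F)) (Etop F) *:%R
  trestr trestr_linear.

Lemma trestr_eq0 rho : trestr rho = 0 <-> terminal_zero (vsval rho).
Proof.
have E1 u v : vsval ((0 : Etop F).1 u v) = 0 by rewrite fst_0 vsval_lfun2_0.
have E2 u v : vsval (vsval (0 : Etop F).2 u v) = 0.
  by rewrite snd_0 (linear0 (@vsval _ _ (vspace_of (is_alt33_submod F)))) vsval_lfun2_0.
split=> [rho0|[h24 h33]].
  have [h1 h2] := trestrP rho; rewrite rho0 in h1 h2.
  split=> x y xi yj.
    exact: etrans (esym (h1 (Subvs xi) (Subvs yj))) (E1 _ _).
  exact: etrans (esym (h2 (Subvs xi) (Subvs yj))) (E2 _ _).
apply: trestr_uniq; split=> u v.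
  exact: etrans (E1 u v) (esym (h24 _ _ (subvsP u) (subvsP v))).
exact: etrans (E2 u v) (esym (h33 _ _ (subvsP u) (subvsP v))).
Qed.

(** For the converse, a class in the pencil is the class of a combination [w] of the psi_i. Then rho
    - w is a coboundary, and both it and [w] vanish on pairs of the derived algebra. *)
Lemma trestr_ker (rho : subvs_of (Z20 F)) : 2%:R != 0 :> F ->
  trestr rho = 0 <-> class20 rho \in pencil F.
Proof.
move=> nz2; split=> [/trestr_eq0|]; first exact: terminal_zero_pencil.
have ker_psi i : trestr (psi F i) = 0.
  apply/trestr_eq0; split=> x y /mem_grade x0 /mem_grade y0.
    apply: (cochain_vanish (P := fun b => gdeg b == 2%N) (Q := fun b => gdeg b == 4%N)).
    + by move=> u v /eqP ui /eqP vj; rewrite /psi /= table_cochain_bas psi_derived ?ui ?vj.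
    + by move=> u /x0.
    + by move=> u /y0.
  apply: (cochain_vanish (P := fun b => gdeg b == 3%N) (Q := fun b => gdeg b == 3%N)).
  + by move=> u v /eqP ui /eqP vj; rewrite /psi /= table_cochain_bas psi_derived ?ui ?vj.
  + by move=> u /x0.
  + by move=> u /y0.
have ker_B (tau : subvs_of (Z20 F)) : class20 tau = 0 -> trestr tau = 0.
  move=> t0; have : tau - 0 \in B20 F.
    by rewrite -qproj_eq [X in _ == X]linear0; apply/eqP.
  rewrite subr0 => /(mem_vspace_of (is_coboundary0_submod F))[f fd fE].
  apply/trestr_eq0; split=> x y xi yj; rewrite fE.
    exact: (d1_derived (i := 2) (j := 4)).
  exact: (d1_derived (i := 3) (j := 3)).
have span0 : (<<[seq psi F i | i <- enum 'I_3]>> <= lker (linfun (trestr)))%VS.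
  by apply/span_subvP => _ /mapP[i _ ->]; rewrite memv_ker lfunE; apply/eqP/ker_psi.
have -> : pencil F = (linfun (@class20 F) @: <<[seq psi F i | i <- enum 'I_3]>>)%VS.
  rewrite limg_span -map_comp; congr span; apply: eq_map => i.
  by rewrite /= lfunE.
move=> /memv_imgP[w /(subvP span0)]; rewrite memv_ker !lfunE => /eqP w0 rw.
have /ker_B : class20 (rho - w) = 0 by rewrite linearB /= rw subrr.
by rewrite linearB /= w0 subr0.
Qed.

(** * Surjectivity and the dimension of the target *)

Lemma dual_cocycle_entries (h : entry -> F) t : t \in terminal_entries ->
  vsval (dual_cocycle (\row_j h (tentry j))) (e t.1.1) (e t.1.2) t.2 = h t.
Proof.
move=> tt; have t8 : (index t terminal_entries < 8)%N by rewrite index_mem.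
have tE : tentry (Ordinal t8) = t by apply: nth_index.
by have := dual_cocycle_terminal (\row_j h (tentry j)) (Ordinal t8); rewrite mxE tE.
Qed.

Lemma eq_grade6 x y : x \in grade F 6 -> y \in grade F 6 ->
  x gT0 = y gT0 -> x gT1 = y gT1 -> x = y.
Proof. by move=> x6 y6 h0 h1; rewrite (grade6_sum x6) (grade6_sum y6) h0 h1. Qed.

Lemma trestr_surj (E : Etop F) : exists c, trestr (dual_cocycle c) = E.
Proof.
(* Precomposing with projections onto the layers extends [f] to a cochain on the whole algebra, so
   that the basis lemmas apply to it. *)
have bil i j (f : 'Hom(L i, 'Hom(L j, L 6))) : exists b : cochain2 F,
    (forall x y, b x y = vsval (f (vsproj (grade F i) x) (vsproj (grade F j) y))) /\
    forall u v, vsval (f u v) = b (vsval u) (vsval v).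
  have [||b bE] := @bilinear_cochain F
    (fun x y => vsval (f (vsproj (grade F i) x) (vsproj (grade F j) y))).
  - by move=> x a y z; rewrite !linearP.
  - by move=> y a x z; rewrite linearP linearP add_lfunE scale_lfunE linearP.
  by exists b; split=> // u v; rewrite bE !vsvalK.
have [b1 [b1E b1V]] := bil _ _ E.1; have [b2 [b2E b2V]] := bil _ _ (vsval E.2).
(* The coordinates of [E]: the degree of the first argument, 2 or 3, tells which component is
   read. *)
pose h (t : entry) : F :=
  (if gdeg t.1.1 == 2%N then b1 else b2) (e t.1.1) (e t.1.2) t.2.
exists (\row_j h (tentry j)); apply: trestr_uniq.
set rho := dual_cocycle _; have rhoE t : t \in terminal_entries ->
  vsval rho (e t.1.1) (e t.1.2) t.2 = h t by apply: dual_cocycle_entries.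
have [alt rhod _] := cocycle20P rho.
have b2alt x : b2 x x = 0.
  have : vsval E.2 \in vspace_of (is_alt33_submod F) := subvsP _.
  by move=> /(mem_vspace_of (is_alt33_submod F)) alt2; rewrite b2E alt2 linear0.
have b2anti := alternating_anti b2alt; have anti := alternating_anti alt.
have E6 u v (b : cochain2 F) : (gdeg u + gdeg v = 6)%N ->
    b (e u) (e v) \in grade F 6 ->
    (u, v, gT0) \in terminal_entries -> (u, v, gT1) \in terminal_entries ->
    h (u, v, gT0) = b (e u) (e v) gT0 -> h (u, v, gT1) = b (e u) (e v) gT1 ->
    (b - vsval rho) (e u) (e v) = 0.
  move=> uv b6 t0 t1 h0 h1; rewrite !(add_lfunE, opp_lfunE); apply/eqP.
  rewrite subr_eq0; apply/eqP; apply: eq_grade6 => //.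
  - by rewrite -uv; apply: rhod; apply: gbas_grade.
  - by rewrite -h0 -(rhoE _ t0).
  - by rewrite -h1 -(rhoE _ t1).
have diff1 x y : x \in grade F 2 -> y \in grade F 4 -> (b1 - vsval rho) x y = 0.
  move=> /mem_grade x0 /mem_grade y0.
  apply: (cochain_vanish (P := fun b => gdeg b == 2%N) (Q := fun b => gdeg b == 4%N)).
  + case=> // v _ v4; apply: E6 => //; first by rewrite (eqP v4).
    * by rewrite b1E subvsP.
    * by case: v v4.
    * by case: v v4.
  + by move=> u /x0.
  + by move=> u /y0.
have diff2 x y : x \in grade F 3 -> y \in grade F 3 -> (b2 - vsval rho) x y = 0.
  move=> /mem_grade x0 /mem_grade y0.
  have xy0 : (b2 - vsval rho) (e gZx) (e gZy) = 0.
    by apply: E6 => //; rewrite b2E subvsP.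
  have d3 z : (b2 - vsval rho) z z = 0.
    by rewrite !(add_lfunE, opp_lfunE) alt b2alt subrr.
  apply: (cochain_vanish (P := fun b => gdeg b == 3%N) (Q := fun b => gdeg b == 3%N)).
  + case=> // -[] // _ _; rewrite ?d3 //.
    by rewrite (alternating_anti d3) xy0 oppr0.
  + by move=> u /x0.
  + by move=> u /y0.
have sub0 (b : cochain2 F) x y : (b - vsval rho) x y = 0 -> b x y = vsval rho x y.
  by rewrite !(add_lfunE, opp_lfunE) => /eqP; rewrite subr_eq0 => /eqP.
split=> u v.
  exact: etrans (b1V u v) (sub0 _ _ _ (diff1 _ _ (subvsP u) (subvsP v))).
exact: etrans (b2V u v) (sub0 _ _ _ (diff2 _ _ (subvsP u) (subvsP v))).
Qed.

(** The map [T] from the 8-dimensional row space is bijective: a row is read off from the terminal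
    values of its cocycle, and surjectivity is [trestr_surj]. *)
Lemma dim_Etop : \dim {: Etop F} = 8%N.
Proof.
pose T : {linear 'rV[F]_8 -> Etop F} := trestr \o dual_cocycle.
have T0 c : T c = 0 -> c = 0.
  move=> Tc; apply/rowP => j; rewrite mxE -dual_cocycle_terminal.
  have [h24 h33] : terminal_zero (vsval (dual_cocycle c)) by apply/trestr_eq0.
  have [[d1 d2]|[d1 d2]] : ((gdeg (tentry j).1.1 = 2) /\ (gdeg (tentry j).1.2 = 4) \/
     (gdeg (tentry j).1.1 = 3) /\ (gdeg (tentry j).1.2 = 3))%N.
    by case: j => [[|[|[|[|[|[|[|[|//]]]]]]]] ltj]; [left|left|left|left|left|left|right|right].
  - have : e (tentry j).1.1 \in _ := gbas_grade _.
    have : e (tentry j).1.2 \in _ := gbas_grade _.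
    by rewrite d1 d2 => g2 g1; rewrite (h24 _ _ g1 g2) ffunE.
  - have : e (tentry j).1.1 \in _ := gbas_grade _.
    have : e (tentry j).1.2 \in _ := gbas_grade _.
    by rewrite d1 d2 => g2 g1; rewrite (h33 _ _ g1 g2) ffunE.
have ker0 : lker (linfun T) == 0%VS.
  by apply/lker0P => c c'; rewrite !lfunE => /eqP; rewrite -subr_eq0 -linearB => /eqP/T0/eqP;
    rewrite subr_eq0 => /eqP.
have <- : limg (linfun T) = fullv.
  apply/eqP; rewrite eqEsubv subvf; apply/subvP => E _.
  have [c <-] := trestr_surj E.
  by apply/memv_imgP; exists c; rewrite ?memvf // lfunE.
by rewrite limg_dim_eq ?dimvf ?(eqP ker0) ?capv0 //; apply: dim_matrix.
Qed.

(** * Terminal values determine the metabelian defect *)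

Lemma derived_low x b : x \in derived F -> (gdeg b <= 1)%N -> x b = 0.
Proof.
move=> xd b1; move: x xd; rewrite /derived big_nat.
elim/big_rec: _ => [x|j V /andP[j2 _] IH x].
  by rewrite memv0 => /eqP ->; rewrite ffunE.
move=> /memv_addP[y yj [z zV ->]]; rewrite ffunE (IH z zV).
move/mem_grade: yj => -> //; first by rewrite [LHS]addr0.
by rewrite neq_ltn (leq_ltn_trans b1).
Qed.

Lemma terminal_zero_defect (rho : subvs_of (Z20 F)) x y :
  terminal_zero (vsval rho) -> x \in derived F -> y \in derived F ->
  vsval rho x y = 0.
Proof.
move=> [h24 h33] xd yd.
have meta := terminal_metabelian (cocycle20P rho) h24 h33.
apply: (cochain_vanish (P := fun b => (1 < gdeg b)%N) (Q := fun b => (1 < gdeg b)%N)).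
- by move=> u v u1 v1; apply: (meta _ _ _ _ u1 v1); apply: gbas_grade.
- by move=> u; rewrite -leqNgt; apply: derived_low.
- by move=> u; rewrite -leqNgt; apply: derived_low.
Qed.

End Cochains.

(** * Descent to the quotient by the pencil *)

Theorem proposition7p2 (F : fieldType) (char0 : [pchar F] =i pred0) :
  [/\ exists Phi : {linear quotv (pencil F) -> Etop F},
        bijective Phi /\
        forall phi : subvs_of (Z20 F),
          terminal_restriction phi (Phi (qproj (pencil F) (class20 phi))),
      \dim {: Etop F} = 8%N
    & forall e : Etop F,
        (exists phi : subvs_of (Z20 F), terminal_restriction phi e) /\
        forall phi phi' : subvs_of (Z20 F),
          terminal_restriction phi e -> terminal_restriction phi' e ->
          class20 phi - class20 phi' \in pencil F /\
          forall u v : subvs_of (derived F),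
            metabelian_defect phi u v = metabelian_defect phi' u v].
Proof.
have nz2 : 2%:R != 0 :> F by rewrite (pcharf0P F).1.
(* The kernel statement for differences: one direction makes [Phi] well defined, the other makes it
   injective. *)
have trestr_eq (phi phi' : subvs_of (Z20 F)) : trestr phi = trestr phi' <->
    class20 phi - class20 phi' \in pencil F.
  have B : class20 phi - class20 phi' = class20 (phi - phi') by rewrite linearB.
  have R : trestr (phi - phi') = trestr phi - trestr phi' by rewrite linearB.
  rewrite B; split=> [eq_tr|/(trestr_ker (phi - phi') nz2)].
    by apply/(trestr_ker (phi - phi') nz2); rewrite R eq_tr subrr.
  by rewrite R => /eqP; rewrite subr_eq0 => /eqP.
pose q phi := qproj (pencil F) (class20 phi).
have q_surj x : exists phi, x = q phi.
  have [y ->] := qproj_surj x; have [phi ->] := qproj_surj y.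
  by exists phi.
(* Defined on a chosen cocycle representative; [PhiE] shows independence of the choice. *)
pose Phi x := trestr (sval (cid (q_surj x))).
have PhiE phi : Phi (q phi) = trestr phi.
  rewrite /Phi; case: cid => phi' /= /eqP; rewrite qproj_eq => /trestr_eq.
  by [].
have q_linear a phi phi' : a *: q phi + q phi' = q (a *: phi + phi').
  by rewrite /q !linearP.
have Phi_linear : linear Phi.
  move=> a x y; have [phi ->] := q_surj x; have [phi' ->] := q_surj y.
  by rewrite q_linear !PhiE linearP.
have Phi_inj : injective Phi.
  move=> x y; have [phi ->] := q_surj x; have [phi' ->] := q_surj y.
  by rewrite !PhiE => /trestr_eq; rewrite -qproj_eq => /eqP.
have Phi_surj E : exists x, Phi x = E.
  by have [c <-] := trestr_surj E; exists (q (dual_cocycle c)); rewrite PhiE.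
split; last 1 first.
- move=> E; split.
    have [c <-] := trestr_surj E; exists (dual_cocycle c); exact: trestrP.
  move=> phi phi' /trestr_uniq phiE /trestr_uniq phi'E; split.
    by apply/trestr_eq; rewrite phiE phi'E.
  move=> u v; rewrite /metabelian_defect; apply/eqP; rewrite -subr_eq0; apply/eqP.
  have tz : terminal_zero (vsval (phi - phi')).
    by apply/trestr_eq0; rewrite linearB /= phiE phi'E subrr.
  have := terminal_zero_defect tz (subvsP u) (subvsP v).
  by rewrite (linearB (@vsval _ _ (Z20 F))) !(add_lfunE, opp_lfunE).
- pose PhiL : {linear quotv (pencil F) -> Etop F} := HB.pack Phi
    (GRing.isLinear.Build F (quotv (pencil F)) (Etop F) *:%R Phi Phi_linear).
  exists PhiL; split=> [|phi] /=.
    exists (fun E => sval (cid (Phi_surj E))) => [x|E].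
      by apply: Phi_inj; case: cid.
    by case: cid.
  by have := trestrP phi; rewrite -PhiE.
- exact: dim_Etop.
Qed.
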